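(* Let $X$ be a simplicial complex satisfying the condition $SD_2^{\ast}$. Then the universal cover of $X$ is weakly systolic.
   Context: Conventions: the complex $X$ is assumed connected; simplices are finite, and complexes are assumed to contain no infinite set of pairwise adjacent vertices. For vertices $v,w$ write $v\sim w$ if they span an edge. $d$ denotes the path metric of the $1$-skeleton on the vertex set. $X$ is flag if every finite set of pairwise adjacent vertices spans a simplex. For a simplex $\sigma$, the link $X_\sigma$ is the subcomplex of simplices $\tau$ with $\tau\cap\sigma=\emptyset$ such that $\tau\cup\sigma$ spans a simplex of $X$. For a subcomplex $A$, $B_i(A)=B_i(A,X)$ (resp. $S_i(A)$) is the full subcomplex spanned by the vertices at distance at most $i$ (resp. exactly $i$) from the vertex set of $A$. Weak systolicity: property $\widetilde{SD}_n(A)$ of a flag complex means that for every $i=1,\dots,n$, (E) for every edge $e\in S_{i+1}(A)$ the intersection $X_e\cap B_i(A)$ is non-empty; (V) for every vertex $w\in S_{i+1}(A)$ the intersection $X_w\cap B_i(A)$ is a single simplex. A complex is weakly systolic if it is flag and satisfies $\widetilde{SD}_n(v)$ for every $n\in\mathbb N$ and every vertex $v$. Wheels: for $k\ge 4$ a $k$-wheel $(v_0;v_1,\dots,v_k)$ is a full subcomplex of $X$ such that $(v_1,\dots,v_k,v_1)$ is a full $k$-cycle (distinct vertices, cyclically consecutive ones adjacent, no other adjacencies among them) and $v_0$ is adjacent to all $v_1,\dots,v_k$. A $k$-wheel with a pendant triangle $(v_0;v_1,\dots,v_k;t)$ is the union of a $k$-wheel $(v_0;v_1,\dots,v_k)$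 and a triangle $\langle v_1,v_2,t\rangle$ of $X$ with $t\ne v_i$ for $i=0,\dots,k$ (not required to be a full subcomplex). $SD_2^{\ast}$: a flag simplicial complex $X$ satisfies $SD_2^{\ast}$ if (a) $X$ contains no $4$-wheels; (b) for every $5$-wheel with a pendant triangle $\widehat W$ in $X$ there is a vertex $v$ with $\widehat W\subseteq B_1(v,X)$. *)

(* Defs.v *)
From mathcomp Require Import all_boot finmap.
From mathcomp Require Import boolp classical_sets cardinality.

Set Implicit Arguments.
Unset Strict Implicit.
Unset Printing Implicit Defensive.

Local Open Scope fset_scope.

(* Abstract simplicial complexes.  Every element of V is a vertex, and the    *)
(* empty set is not a simplex.                                                *)
Record complex (V : choiceType) := Complex {
  simplex :> {fset V} -> Prop;
  simplex_neq0 : forall s : {fset V}, simplex s -> s != fset0;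
  simplex_vertex : forall v, simplex [fset v];
  simplex_face : forall s t : {fset V}, simplex s -> t != fset0 -> t `<=` s -> simplex t
}.

Section Complexes.
Variables (V : choiceType) (X : complex V).
Implicit Types (u v w : V) (A U : set V) (s t e : {fset V}).

Definition adj u v : bool := (u != v) && `[< X [fset u; v] >].

Definition connected : Prop :=
  inhabited V /\
  forall u v, exists2 p : seq V, path adj u p & last u p = v.

Definition no_infinite_clique : Prop :=
  forall A, (forall u v, A u -> A v -> u != v -> adj u v) -> finite_set A.

Definition flag : Prop :=
  forall s, s != fset0 ->
    {in s &, forall u v, u != v -> adj u v} -> X s.

(* Subcomplexes are represented by their sets of (nonempty) simplices.        *)

Definition faces s : set {fset V} := [set t : {fset V} | t != fset0 /\ (t `<=` s)%fset]%classic.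

Definition full U : set {fset V} :=
  [set s | X s /\ {in s, forall v, U v}]%classic.

Definition link s : set {fset V} :=
  [set t | [/\ X t, [disjoint t & s]%fset & X (t `|` s)%fset]]%classic.

(* A stands for the vertex set of a subcomplex: balls and spheres around a    *)
(* subcomplex depend on nothing else.                                         *)
Definition dist_le A (i : nat) v : Prop :=
  exists a (p : seq V), [/\ A a, path adj a p, last a p = v & size p <= i].

Definition dist_eq A (i : nat) v : Prop :=
  dist_le A i v /\ forall j, j < i -> ~ dist_le A j v.

Definition ball (i : nat) A : set {fset V} := full (dist_le A i).
Definition sphere (i : nat) A : set {fset V} := full (dist_eq A i).

Definition weak_SD (n : nat) A : Prop :=
  forall i, 1 <= i <= n ->
    (forall e, sphere i.+1 A e -> #|` e| = 2 ->
       (link e `&` ball i A !=set0)%classic) /\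
    (forall w, sphere i.+1 A [fset w] ->
       exists2 s, X s &
         (link [fset w] `&` ball i A)%classic = faces s).

Definition weakly_systolic : Prop :=
  flag /\ forall n v, weak_SD n [set v]%classic.

(* The rim v_1, ..., v_k is indexed from 0, cyclically through ordS.          *)
Definition wheel k (v0 : V) (c : k.-tuple V) : Prop :=
  [/\ 4 <= k,
      uniq c,
      forall i j : 'I_k,
        adj (tnth c i) (tnth c j) <-> (j = ordS i \/ i = ordS j) &
      forall i : 'I_k, adj v0 (tnth c i)].

Definition wheel_subcomplex k (v0 : V) (c : k.-tuple V) : set {fset V} :=
  full [set v | v \in v0 :: c]%classic.

Definition pendant_triangle (v0 : V) (c : seq V) (t : V) : {fset V} :=
  [fset nth v0 c 0; nth v0 c 1; t].

Definition wheel_with_pendant_triangle k (v0 : V) (c : k.-tuple V) (t : V) : Prop :=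
  [/\ wheel v0 c, X (pendant_triangle v0 c t) & t \notin v0 :: c].

Definition pendant_wheel_subcomplex k (v0 : V) (c : k.-tuple V) (t : V) :
    set {fset V} :=
  (wheel_subcomplex v0 c `|` faces (pendant_triangle v0 c t))%classic.

Definition SD2star : Prop :=
  [/\ flag,
      forall v0 (c : 4.-tuple V), ~ wheel v0 c &
      forall v0 (c : 5.-tuple V) (t : V), wheel_with_pendant_triangle v0 c t ->
        exists v,
          (pendant_wheel_subcomplex v0 c t `<=` ball 1 [set v])%classic].

(* Homotopy of edge paths relative to their endpoints: two edge paths, given  *)
(* by their vertex sequences, are homotopic when they differ by finitely many *)
(* backtracks and moves across 2-simplices.                                   *)
Inductive homotopic : seq V -> seq V -> Prop :=
| homotopic_refl p : homotopic p p
| homotopic_sym p q : homotopic p q -> homotopic q p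
| homotopic_trans p q r : homotopic p q -> homotopic q r -> homotopic p r
| homotopic_backtrack p q u v : adj u v ->
    homotopic (p ++ [:: u, v, u & q]) (p ++ u :: q)
| homotopic_triangle p q u v w : uniq [:: u; v; w] -> X [fset u; v; w] ->
    homotopic (p ++ [:: u, v, w & q]) (p ++ [:: u, w & q]).

Definition simply_connected : Prop :=
  connected /\
  forall u p, path adj u p -> last u p = u -> homotopic (u :: p) [:: u].

End Complexes.

(* Every simplex of X has, through each lift of each of its vertices, exactly *)
(* one lift; equivalently, the realization of f is a covering map.            *)
Definition covering (V W : choiceType) (X : complex V) (Y : complex W)
    (f : W -> V) : Prop :=
  [/\ forall t, Y t -> X [fset f y | y in t],
      forall x, exists y, f y = x,
      forall t, Y t -> {in t &, injective f} &
      forall y s, X s -> f y \in s ->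
        exists! t, [/\ Y t, y \in t & [fset f z | z in t] = s]].

Definition universal_cover (V W : choiceType) (X : complex V) (Y : complex W)
    (f : W -> V) : Prop :=
  covering X Y f /\ simply_connected Y.

(* Main.v *)
Require Import Defs.
From mathcomp Require Import all_boot finmap.
From mathcomp Require Import boolp classical_sets cardinality.

(** Both the hypothesis and the conclusion live on the 1-skeleton of Y.  A
covering restricts to an isomorphism between the closed star of each vertex
and the closed star of its image ([covering_star_iso]), so Y inherits from X
flagness, finiteness of cliques, the absence of 4-wheels and the domination of
5-wheels with a pendant triangle; and Y is simply connected.

Fix a base vertex o of Y.  A second graph H is built sphere by sphere around a
root, together with a map to Y, so that it obviously satisfies the two
conditions (E) and (V) around its root.  Let S_n be the last sphere built.  A
pair (w, z) is fresh if w is in S_n and z is a neighbour of the image of w that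
is not yet the image of a neighbour of w.  The next sphere consists of the
fresh pairs, where (w, z) and (w', z) are identified if w and w' are equal or
adjacent in S_n: adjacent vertices w, w' must see the same vertex over z.  Two
new vertices are joined if their images are adjacent and they have a common
parent in S_n.

The crux is that the identification is transitive ([twin_trans]).  Suppose that
w1, w2, w3 are consecutive in S_n, fresh towards z, and w1, w3 are not adjacent.
A common parent of all three would give the 4-wheel (w2; w1, z, w3, parent) in
Y.  Otherwise a common parent u of w1, w2 and a common parent u' of w2, w3 are
adjacent, and (w2; u, u', w3, z, w1) is a 5-wheel; a common parent t of u and
u' makes a pendant triangle.  A vertex dominating this configuration lifts to a
neighbour of u, t and w2, hence to a parent of w2 whose image is adjacent to z,
and then z would have been seen before.  The absence of 4-wheels gives in
addition that adjacency is still reflected among the neighbours of the new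
vertices ([rigid_succ]).

So H covers Y ([vertex_covers]), and edge paths and their homotopies lift to H
([lifts_homotopic]).  As Y is simply connected the map is injective
([last_inj]).  Hence H is the 1-skeleton of Y, the spheres of H are the spheres
of Y around o ([dist_leP]), and (E) and (V) hold in Y. *)

Set Implicit Arguments.
Unset Strict Implicit.
Unset Printing Implicit Defensive.

Local Open Scope fset_scope.

(** * Wheels in graphs, and maps that are isomorphisms on stars *)

Definition W4_free (T : eqType) (d : rel T) : Prop :=
  forall c a1 a2 a3 a4, all (d c) [:: a1; a2; a3; a4] ->
    [&& d a1 a2, d a2 a3, d a3 a4 & d a4 a1] ->
    a1 != a3 -> a2 != a4 -> d a1 a3 || d a2 a4.

Definition within1 (T : eqType) (d : rel T) x y := (x == y) || d x y.

(** Distinctness of the rim vertices is implied by the non-adjacencies: if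
[a1 = a3], say, then [a3] adjacent to [a4] contradicts [~~ d a1 a4]. *)
Definition wheel5 (T : eqType) (d : rel T) c a1 a2 a3 a4 a5 : bool :=
  [&& all (d c) [:: a1; a2; a3; a4; a5],
      [&& d a1 a2, d a2 a3, d a3 a4, d a4 a5 & d a5 a1] &
      [&& ~~ d a1 a3, ~~ d a1 a4, ~~ d a2 a4, ~~ d a2 a5 & ~~ d a3 a5]].

Definition W5_dominated (T : eqType) (d : rel T) : Prop :=
  forall c a1 a2 a3 a4 a5 t, wheel5 d c a1 a2 a3 a4 a5 ->
    d a1 t -> d a2 t -> t \notin [:: c; a1; a2; a3; a4; a5] ->
    exists x, all (within1 d x) [:: c; a1; a2; a3; a4; a5; t].

(** The map [f] restricts to an isomorphism between the subgraphs spanned by the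
closed stars of [w] and of [f w], provided that it preserves adjacency.  The
relation [e] is propositional, so that the same notion serves for coverings of
complexes and for the unfolding built below. *)
Definition star_iso (T U : Type) (e : T -> T -> Prop) (d : rel U) (f : T -> U)
    (w : T) : Prop :=
  [/\ forall z, d (f w) z -> exists2 x, e w x & f x = z,
      forall x y, e w x -> e w y -> f x = f y -> x = y &
      forall x y, e w x -> e w y -> d (f x) (f y) -> e x y].

Section StarIso.
Variables (T U : eqType) (e : rel T) (d : rel U) (f : T -> U).
Hypotheses (e_sym : symmetric e) (d_sym : symmetric d) (d_irr : irreflexive d).
Hypothesis f_hom : forall x y, e x y -> d (f x) (f y).
Hypothesis f_iso : forall x, star_iso e d f x.

Lemma star_iso_adj w x y : e w x -> e w y -> d (f x) (f y) = e x y.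
Proof.
move=> wx wy; have [_ _ refl] := f_iso w.
by apply/idP/idP; [apply: refl|apply: f_hom].
Qed.

Lemma star_iso_neq w x y : e w x -> e w y -> x != y -> f x != f y.
Proof.
by move=> wx wy; have [_ inj _] := f_iso w; apply: contra_neq; apply: inj.
Qed.

(** All vertices of a wheel lie in the closed star of its hub. *)
Lemma star_iso_W4 : W4_free d -> W4_free e.
Proof.
move=> W c a1 a2 a3 a4 sp rim n13 n24.
have /and5P[c1 c2 c3 c4 _] := sp; have /and4P[e12 e23 e34 e41] := rim.
rewrite -(star_iso_adj c1 c3) -(star_iso_adj c2 c4).
by apply: (W (f c)); rewrite /= ?f_hom ?(star_iso_neq c1 c3) ?(star_iso_neq c2 c4).
Qed.

Lemma star_iso_within1 w x y : within1 e w x -> within1 e w y ->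
  within1 d (f x) (f y) -> within1 e x y.
Proof.
rewrite /within1 => /predU1P[<-|wx] /predU1P[<-|wy].
- by move=> _; rewrite eqxx.
- by move=> _; rewrite wy orbT.
- by move=> _; rewrite e_sym wx orbT.
rewrite (star_iso_adj wx wy) => /orP[/eqP|->]; last by rewrite orbT.
by have [_ inj _] := f_iso w => /(inj _ _ wx wy) ->; rewrite eqxx.
Qed.

(** The apex [t] of the pendant triangle need not be adjacent to the hub, so its
image is separated from those of [c], [a3] and [a5] in the stars of [a1] and
[a2]; it differs from the image of [a4] because only the former is adjacent to
the image of [a1].  The dominating vertex is lifted at the hub,
and its position with respect to [t] is read in the star of [a1]. *)
Lemma star_iso_W5 : W5_dominated d -> W5_dominated e.
Proof.
move=> W c a1 a2 a3 a4 a5 t wh t1 t2 tn.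
have wh' : wheel5 d (f c) (f a1) (f a2) (f a3) (f a4) (f a5).
  move: wh; rewrite /wheel5 /=.
  case/and3P => /and5P[c1 c2 c3 c4 /andP[c5 _]] /and5P[? ? ? ? ?] nn.
  by rewrite (star_iso_adj c1 c3) (star_iso_adj c1 c4) (star_iso_adj c2 c4)
    (star_iso_adj c2 c5) (star_iso_adj c3 c5) /= nn !f_hom.
move: (wh) => /and3P[] /= /and5P[c1 c2 c3 c4 /andP[c5 _]].
move=> /and5P[e12 e23 e34 e45 e51] /and5P[n13 n14 n24 n25 n35].
have [|||x] := W (f c) (f a1) (f a2) (f a3) (f a4) (f a5) (f t) wh'; rewrite ?f_hom //.
  move: tn; rewrite !inE !negb_or => /and5P[tc ta1 ta2 ta3 /andP[ta4 ta5]].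
  have e1c : e a1 c by rewrite e_sym.
  have e2c : e a2 c by rewrite e_sym.
  have e15 : e a1 a5 by rewrite e_sym.
  have ne x y : d x y -> x != y by apply: contraTneq => ->; rewrite d_irr.
  rewrite (star_iso_neq t1 e1c tc) (star_iso_neq t2 e23 ta3) (star_iso_neq t1 e15 ta5).
  rewrite eq_sym ne ?f_hom // eq_sym ne ?f_hom //= andbT.
  apply: contraNneq n14 => E.
  by rewrite -(star_iso_adj c1 c4) -E f_hom.
move=> /= /and5P[xc x1 x2 x3 /and4P[x4 x5 xt _]].
have [y cy yx] : exists2 y, within1 e c y & f y = x.
  have [lift _ _] := f_iso c; move: xc => /predU1P[->|].
    by exists c; rewrite // /within1 eqxx.
  by rewrite d_sym => /lift[y cy <-]; exists y; rewrite // /within1 cy orbT.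
exists y; rewrite -yx in x1 x2 x3 x4 x5 xt.
have w1 u v : e u v -> within1 e u v by rewrite /within1 orbC => ->.
have cl u : e c u -> within1 d (f y) (f u) -> within1 e y u.
  by move=> /w1; apply: star_iso_within1.
have y1 := cl _ c1 x1.
have yc : within1 e y c by rewrite /within1 eq_sym e_sym.
rewrite /= yc y1 (cl _ c2 x2) (cl _ c3 x3) (cl _ c4 x4) (cl _ c5 x5) andbT /=.
apply: (star_iso_within1 (w := a1)) xt; last exact: w1.
by rewrite /within1 eq_sym e_sym.
Qed.

End StarIso.

(** * The 1-skeleton of a complex *)

Section ComplexGraph.
Variables (V : choiceType) (X : complex V).
Implicit Types (u v w : V) (s t : {fset V}).

Lemma adj_sym : symmetric (adj X).
Proof. by move=> u v; rewrite /adj eq_sym fsetUC. Qed.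

Lemma adj_irr : irreflexive (adj X).
Proof. by move=> u; rewrite /adj eqxx. Qed.

Lemma simplex_adj s u v : X s -> u \in s -> v \in s -> u != v -> adj X u v.
Proof.
move=> Xs us vs uv; rewrite /adj uv; apply/asboolP; apply: simplex_face Xs _ _.
  by apply/fset0Pn; exists u; rewrite !inE eqxx.
by apply/fsubsetP => x; rewrite !inE => /orP[] /eqP->.
Qed.

Lemma dist_le1 v y : dist_le X [set v]%classic 1 y -> within1 (adj X) v y.
Proof.
case=> a [[|b [|? ?]] [-> /= pa <- //] _]; first by rewrite /within1 eqxx.
by move: pa; rewrite /within1 andbT => ->; rewrite orbT.
Qed.

Lemma W4_free_adj : SD2star X -> W4_free (adj X).
Proof.
move=> [_ no4 _] c a1 a2 a3 a4 /= /and5P[c1 c2 c3 c4 _] /and4P[e12 e23 e34 e41] n13 n24.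
apply/negPn/negP; rewrite negb_or => /andP[/negbTE a13 /negbTE a24].
have ne x y : adj X x y -> x != y by case/andP.
pose r := [tuple a1; a2; a3; a4]; apply: (no4 c r); split=> //.
- rewrite /= !inE !negb_or n13 n24 (ne _ _ e12) (ne _ _ e23) (ne _ _ e34).
  by rewrite eq_sym (ne _ _ e41).
- suff E (i j : 'I_4) : adj X (tnth r i) (tnth r j) = (j == ordS i) || (i == ordS j).
    by move=> i j; rewrite E; split=> [/orP[] /eqP|[] <-]; rewrite ?eqxx ?orbT; auto.
  have a31 : adj X a3 a1 = false by rewrite adj_sym.
  have a42 : adj X a4 a2 = false by rewrite adj_sym.
  case: i => [[|[|[|[|//]]]] ?]; case: j => [[|[|[|[|//]]]] ?];
  by rewrite !(tnth_nth a1) -!val_eqE /= ?adj_irr // adj_sym.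
- by case=> [[|[|[|[|//]]]] ?]; rewrite (tnth_nth a1).
Qed.

Lemma W5_dominated_adj : SD2star X -> W5_dominated (adj X).
Proof.
move=> [flagX _ W5] c a1 a2 a3 a4 a5 t /and3P[] /= /and5P[c1 c2 c3 c4 /andP[c5 _]].
move=> /and5P[e12 e23 e34 e45 e51].
move=> /and5P[/negbTE n13 /negbTE n14 /negbTE n24 /negbTE n25 /negbTE n35].
move=> t1 t2 tn.
have ne x y : adj X x y -> x != y by case/andP.
have a31 : adj X a3 a1 = false by rewrite adj_sym.
have a41 : adj X a4 a1 = false by rewrite adj_sym.
have a42 : adj X a4 a2 = false by rewrite adj_sym.
have a52 : adj X a5 a2 = false by rewrite adj_sym.
have a53 : adj X a5 a3 = false by rewrite adj_sym.
have d13 : a1 != a3 by apply/eqP => E; move: e34; rewrite -E n14.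
have d14 : a1 != a4 by apply/eqP => E; move: e34; rewrite -E a31.
have d24 : a2 != a4 by apply/eqP => E; move: e45; rewrite -E n25.
have d25 : a2 != a5 by apply/eqP => E; move: e45; rewrite -E a42.
have d35 : a3 != a5 by apply/eqP => E; move: e51; rewrite -E a31.
pose r := [tuple a1; a2; a3; a4; a5].
have wr : wheel X c r.
  split=> //.
  - rewrite /= !inE !negb_or d13 d14 d24 d25 d35 (ne _ _ e12) (ne _ _ e23) (ne _ _ e34).
    by rewrite (ne _ _ e45) eq_sym (ne _ _ e51).
  - suff E (i j : 'I_5) : adj X (tnth r i) (tnth r j) = (j == ordS i) || (i == ordS j).
      by move=> i j; rewrite E; split=> [/orP[] /eqP|[] <-]; rewrite ?eqxx ?orbT; auto.
    case: i => [[|[|[|[|[|//]]]]] ?]; case: j => [[|[|[|[|[|//]]]]] ?];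
    by rewrite !(tnth_nth a1) -!val_eqE /= ?adj_irr // adj_sym.
  - by case=> [[|[|[|[|[|//]]]]] ?]; rewrite (tnth_nth a1).
have Xt : X (pendant_triangle c r t).
  apply: flagX; first by apply/fset0Pn; exists t; rewrite !inE eqxx !orbT.
  have T1 : adj X t a1 by rewrite adj_sym.
  have T2 : adj X t a2 by rewrite adj_sym.
  have e21 : adj X a2 a1 by rewrite adj_sym.
  move=> x y; rewrite !inE /= -!orbA.
  by move=> /or3P[] /eqP-> /or3P[] /eqP->; rewrite ?eqxx.
have [//|x xW] := W5 c r t.
have dx y : (pendant_wheel_subcomplex X c r t) [fset y] -> within1 (adj X) x y.
  by move=> /xW [_ /(_ y)]; rewrite inE eqxx => /(_ isT)/dist_le1.
exists x; have in_W y : y \in [:: c; a1; a2; a3; a4; a5] -> within1 (adj X) x y.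
  move=> yr; apply: dx; left; split; first exact: simplex_vertex.
  by move=> z; rewrite inE => /eqP ->.
have wt : within1 (adj X) x t.
  apply: dx; right; split; first by apply/fset0Pn; exists t; rewrite inE.
  by apply/fsubsetP => z; rewrite !inE => /eqP ->; rewrite eqxx !orbT.
suff : all (within1 (adj X) x) (rcons [:: c; a1; a2; a3; a4; a5] t) by [].
by rewrite all_rcons wt; apply/allP.
Qed.

End ComplexGraph.

(** * Coverings of complexes *)

Section Covering.
Variables (V W : choiceType) (X : complex V) (Y : complex W) (f : W -> V).
Hypotheses (f_cov : covering X Y f) (X_flag : flag X).

Lemma mem_im (s : {fset W}) y : y \in s -> f y \in [fset f z | z in s].
Proof. exact: in_imfset. Qed.

Lemma covering_adj y z : adj Y y z -> adj X (f y) (f z).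
Proof.
have [simp _ inj _] := f_cov; case/andP => yz /asboolP Yyz.
apply: (simplex_adj (simp _ Yyz)); rewrite ?mem_im ?inE ?eqxx ?orbT //.
by apply: contra_neq yz; apply: (inj _ Yyz); rewrite !inE eqxx ?orbT.
Qed.

(** Two neighbours of [y] with the same image span with [y] two lifts of the same
edge. *)
Lemma covering_adj_inj y z z' : adj Y y z -> adj Y y z' -> f z = f z' -> z = z'.
Proof.
have [_ _ _ lift] := f_cov => yz yz' E; have fyz := covering_adj yz.
have [_ /asboolP Xs] := andP fyz.
have ys : f y \in [fset f y; f z] by rewrite !inE eqxx.
have [t [_ t_uniq]] := lift y _ Xs ys.
have im u : adj Y y u -> f u = f z -> t = [fset y; u].
  case/andP => _ /asboolP Yyu fu; apply: t_uniq; split=> //; first by rewrite !inE eqxx.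
  apply/fsetP => v; apply/imfsetP/idP => /= [[w]|].
    by rewrite !inE => /orP[] /eqP-> ->; rewrite ?fu eqxx ?orbT.
  rewrite !inE => /orP[] /eqP ->; first by exists y; rewrite // !inE eqxx.
  by exists u; rewrite // !inE eqxx orbT.
have : z \in [fset y; z'] by rewrite -(im z') // (im z) // !inE eqxx orbT.
rewrite !inE => /orP[] /eqP // zy.
by move: yz; rewrite zy adj_irr.
Qed.

(** If [f z] and [f z'] are adjacent then flagness fills the triangle
[f y, f z, f z'], whose lift at [y] has to contain [z] and [z']. *)
Lemma covering_star_iso y : star_iso (adj Y) (adj X) f y.
Proof.
have [_ _ inj lift] := f_cov; split=> [x yx|z z'|z z' yz yz' zz'].
- have [_ /asboolP Xs] := andP yx; have ys : f y \in [fset f y; x] by rewrite !inE eqxx.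
  have [t [[Yt yt tE] _]] := lift y _ Xs ys.
  have : x \in [fset f z | z in t] by rewrite tE !inE eqxx orbT.
  case/imfsetP => z /= zt xE; exists z => //; apply: simplex_adj Yt _ _ _ => //.
  by apply: contraTneq yx => ->; rewrite xE adj_irr.
- exact: covering_adj_inj.
have Xs : X [fset f y; f z; f z'].
  have yz_ := covering_adj yz; have yz'_ := covering_adj yz'.
  apply: X_flag; first by apply/fset0Pn; exists (f y); rewrite !inE eqxx.
  move=> a b; rewrite !inE -!orbA => /or3P[] /eqP-> /or3P[] /eqP->; rewrite ?eqxx //;
  by rewrite adj_sym.
have ys : f y \in [fset f y; f z; f z'] by rewrite !inE eqxx.
have [t [[Yt yt tE] _]] := lift y _ Xs ys.
have mem u : adj Y y u -> f u \in [fset f y; f z; f z'] -> u \in t.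
  move=> yu; rewrite -tE => /imfsetP[v /= vt uv].
  have yv : adj Y y v.
    apply: simplex_adj Yt _ _ _ => //; apply: contraTneq (covering_adj yu) => ->.
    by rewrite uv adj_irr.
  by rewrite (covering_adj_inj yu yv uv).
apply: (simplex_adj Yt); rewrite ?mem ?inE ?eqxx ?orbT //.
by apply: contraTneq zz' => ->; rewrite adj_irr.
Qed.

(** The image of a clique spans a simplex, and the lift of that simplex is the
clique itself, since neighbours of [y] are determined by their images. *)
Lemma covering_flag : flag Y.
Proof.
have [_ _ inj lift] := f_cov => s /fset0Pn[y ys] cl.
have Xs : X [fset f z | z in s].
  apply: X_flag; first by apply/fset0Pn; exists (f y); rewrite mem_im.
  move=> _ _ /imfsetP[a /= sa ->] /imfsetP[b /= sb ->] ab.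
  by apply/covering_adj/cl => //; apply: contra_neq ab => ->.
have [|t [[Yt yt tE] _]] := lift y _ Xs; first by rewrite mem_im.
have same (p q : {fset W}) : y \in p -> y \in q ->
    {in p &, forall u v, u != v -> adj Y u v} ->
    {in q &, forall u v, u != v -> adj Y u v} ->
    [fset f z | z in p] = [fset f z | z in q] -> p `<=` q.
  move=> yp yq cp cq E; apply/fsubsetP => a ap.
  have [<- //|ya] := eqVneq y a.
  have : f a \in [fset f z | z in q] by rewrite -E mem_im.
  have {}ya := cp _ _ yp ap ya; case/imfsetP => b /= bq fab.
  have yb : adj Y y b.
    apply: cq => //; apply: contraTneq (covering_adj ya) => ->.
    by rewrite fab adj_irr.
  by rewrite (covering_adj_inj ya yb fab).
have ct : {in t &, forall u v, u != v -> adj Y u v}.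
  by move=> u v tu tv; apply: simplex_adj Yt tu tv.
suff -> : s = t by [].
by apply/eqP; rewrite eqEfsubset !same.
Qed.

Lemma covering_cliques : no_infinite_clique X -> no_infinite_clique Y.
Proof.
move=> fin A cl; have inj : {in A &, injective f}.
  move=> a b; rewrite !inE => Aa Ab fab; apply/eqP/negPn/negP => /(cl _ _ Aa Ab).
  by move/covering_adj; rewrite fab adj_irr.
have : finite_set (f @` A)%classic.
  apply: fin => _ _ [a Aa <-] [b Ab <-] ab; apply/covering_adj/cl => //.
  by apply: contra_neq ab => ->.
by rewrite (eq_finite_set (inj_card_eq inj)).
Qed.

End Covering.

(** * The unfolding of a graph around a vertex *)

(** The vertices of the unfolding are sequences over T.  The length of the
sequence is the distance to the root [[::]], its last entry (or [o]) is its
image, and deleting the last entry gives a distinguished parent.  A class of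
fresh pairs over [z] is thus represented by [rcons w z], where [w] is the first
component of a pair in the class chosen independently of the pair.  The parent
relation is the only primitive datum: siblings are the adjacent vertices of the
same sphere, defined from it. *)
Section Unfolding.
Variables (T : choiceType) (d : rel T) (o : T).
Hypotheses (d_sym : symmetric d) (d_irr : irreflexive d).
Hypotheses (d_W4 : W4_free d) (d_W5 : W5_dominated d).
Implicit Types (x y w u : seq T) (z : T) (P : seq T -> seq T -> Prop).

(** A parent of both ends is required, so the triangle condition (E) holds by
construction. *)
Definition horizontal P x y : Prop :=
  d (last o x) (last o y) /\ exists2 w, P w x & P w y.

(** In this definition [P] stands for the parent relation between the spheres of
radii n - 1 and n. *)
Definition fresh_in n P w z : Prop :=
  [/\ size w = n, w = [::] \/ exists u, P u w, d (last o w) z &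
      forall u, P u w \/ horizontal P w u -> last o u <> z].

(** Any two members of a class give the same value, by extensionality of [choose],
once the relation in the choice predicate is known to be an equivalence. *)
Definition extend (F : seq T -> T -> Prop) P w z : seq T :=
  rcons (choose (fun w' => `[< F w' z /\ (w' = w \/ horizontal P w' w) >]) w) z.

(** The recursion runs sphere by sphere because freshness of a pair depends
negatively on the edges built so far. *)
Fixpoint parent_at n : seq T -> seq T -> Prop :=
  if n is m.+1 then fun w x =>
    let F := fresh_in m (parent_at m) in
    exists2 z, F w z & x = extend F (parent_at m) w z
  else fun _ _ => False.

Definition parent w x := parent_at (size x) w x.
Definition sibling x y := horizontal parent x y.
Definition lower w u := parent u w \/ sibling w u.
Definition vertex w := w = [::] \/ exists u, parent u w.
Definition edge w x := lower w x \/ parent w x.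
Definition fresh w z : Prop :=
  [/\ vertex w, d (last o w) z & forall u, lower w u -> last o u <> z].
Definition child w z := extend fresh parent w z.

Lemma parent_at_size n w x :
  parent_at n w x -> size x = n /\ (size w).+1 = n.
Proof.
case: n => //= n [z Fw ->]; rewrite size_rcons; split; last by case: Fw => ->.
congr _.+1; set Q := fun _ => _.
have /asboolP[] : Q (choose Q w); last by case.
by apply: chooseP; apply/asboolP; split=> //; left.
Qed.

Lemma parent_atE n w x : size x = n -> parent_at n w x = parent w x.
Proof. by move=> <-. Qed.

Lemma parent_size w x : parent w x -> size x = (size w).+1.
Proof. by case/parent_at_size => _ ->. Qed.

Lemma horizontal_at n x y :
  size x = n -> horizontal (parent_at n) x y = sibling x y.
Proof.
move=> sx; apply: propext; split=> -[dxy [w wx wy]]; split=> //; exists w.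
- by rewrite -(parent_atE w sx).
- by have [sy _] := parent_at_size wy; rewrite -(parent_atE w sy).
- by rewrite parent_atE.
- by rewrite parent_atE // (parent_size wy) -(parent_size wx).
Qed.

Lemma fresh_inE n w z :
  fresh_in n (parent_at n) w z <-> size w = n /\ fresh w z.
Proof.
split=> [[sw Vw dwz ow]|[sw [Vw dwz ow]]].
  split=> //; split=> // [|u wu].
    by case: Vw => [->|[u uw]]; [left|right; exists u; rewrite -(parent_atE u sw)].
  apply: ow; case: wu => [uw|wu]; [left|right].
    by rewrite parent_atE.
  by rewrite horizontal_at.
split=> // [|u wu].
  by case: Vw => [->|[u uw]]; [left|right; exists u; rewrite parent_atE].
apply: ow; move: wu; rewrite parent_atE // horizontal_at //.
Qed.

Lemma sibling_sym x y : sibling x y -> sibling y x.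
Proof. by case=> dxy [w wx wy]; split; [rewrite d_sym|exists w]. Qed.

Lemma sibling_size x y : sibling x y -> size x = size y.
Proof. by case=> _ [w /parent_size -> /parent_size ->]. Qed.

Lemma extend_at n w z : size w = n ->
  extend (fresh_in n (parent_at n)) (parent_at n) w z = child w z.
Proof.
move=> sw; congr rcons; apply: eq_choose => w' /=; apply: asbool_equiv_eq.
split=> [[/fresh_inE[sw' Fw'] ww']|[Fw' ww']].
  by split=> //; rewrite -[horizontal parent _ _]/(sibling w' w) -(horizontal_at w sw').
have sw' : size w' = n by case: ww' => [->|/sibling_size ->].
by split; [apply/fresh_inE|rewrite horizontal_at].
Qed.

Lemma child_size w z : fresh w z -> size (child w z) = (size w).+1.
Proof.
move=> Fw; rewrite size_rcons; congr _.+1; set Q := fun _ => _.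
have /asboolP[_ [->|/sibling_size]//] : Q (choose Q w).
by apply: chooseP; apply/asboolP; split=> //; left.
Qed.

(** The stratified definition of [parent] satisfies its intended circular
equation. *)
Lemma parentP w x : parent w x <-> exists2 z, fresh w z & x = child w z.
Proof.
split=> [wx|[z Fw xE]].
  move: (wx); rewrite /parent (parent_size wx) /= => -[z /fresh_inE[_ Fw] ->].
  by exists z; rewrite ?extend_at.
rewrite xE /parent (child_size Fw) /=; exists z; first exact/fresh_inE.
by rewrite extend_at.
Qed.

Lemma last_child w z : last o (child w z) = z.
Proof. by rewrite last_rcons. Qed.

Lemma parent_child w z : fresh w z -> parent w (child w z).
Proof. by move=> Fw; apply/parentP; exists z. Qed.

Lemma parent_fresh w x : parent w x -> fresh w (last o x) /\ x = child w (last o x).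
Proof. by case/parentP => z Fw ->; rewrite last_child. Qed.

Lemma parent_vertex w x : parent w x -> vertex w /\ vertex x.
Proof. by move=> wx; split; [have [[]] := parent_fresh wx|right; exists w]. Qed.

Lemma sibling_vertex w x : sibling w x -> vertex w /\ vertex x.
Proof.
by case=> _ [u /parent_vertex[_ ?] /parent_vertex[_ ?]].
Qed.

Lemma edge_vertex w x : edge w x -> vertex w /\ vertex x.
Proof.
by case=> [[/parent_vertex[]|/sibling_vertex[]]|/parent_vertex[]].
Qed.

Lemma edge_sym w x : edge w x -> edge x w.
Proof.
case=> [[wx|/sibling_sym wx]|wx]; [by right|by left; right|by left; left].
Qed.

Lemma parent_d w x : parent w x -> d (last o w) (last o x).
Proof. by case/parent_fresh => -[]. Qed.

Lemma edge_d w x : edge w x -> d (last o w) (last o x).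
Proof.
by case=> [[/parent_d|[]]|/parent_d]; rewrite // d_sym.
Qed.

Lemma edge_same_size w x : edge w x -> size w = size x -> sibling w x.
Proof.
by case=> [[/parent_size ->|//]|/parent_size ->] => [/esym|] /n_Sn.
Qed.

Lemma edge_lt_size w x : edge w x -> size x < size w -> parent x w.
Proof.
case=> [[//|/sibling_size ->]|/parent_size ->]; rewrite ?ltnn //.
by rewrite ltnNge leqnSn.
Qed.

Lemma lower_size w x : lower w x -> size x <= size w.
Proof. by case=> [/parent_size ->|/sibling_size ->]. Qed.

Lemma edge_size w x : edge w x -> size x <= (size w).+1.
Proof. by case=> [/lower_size /leqW|/parent_size ->]. Qed.


Lemma edge_lower w x : edge w x -> size x <= size w -> lower w x.
Proof. by case=> // /parent_size ->; rewrite ltnn. Qed.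

(** Fresh pairs over the same vertex are to be identified when their first
components are twins. *)
Definition twin w w' := w = w' \/ sibling w w'.
(** The part of [covers] that makes sense before the next sphere exists. *)
Definition rigid w := forall x y, lower w x -> lower w y ->
  (last o x = last o y -> x = y) /\ (d (last o x) (last o y) -> edge x y).
Definition covers w := star_iso edge d (last o) w.
Definition parents_clique x := forall w w', parent w x -> parent w' x -> twin w w'.

(** Otherwise [z] lifts to a neighbour of [u], and this lift is also a neighbour
of [w], because the star of [u] maps isomorphically. *)
Lemma fresh_far u w z : covers u -> parent u w -> fresh w z -> ~~ d (last o u) z.
Proof.
move=> [lift _ refl] uw [_ dwz oz]; apply/negP => /lift[x ux xz].
have wx : edge w x by apply: refl ux _; [right|rewrite xz].
apply: (oz x) xz; apply: edge_lower wx _.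
by rewrite (parent_size uw); apply: edge_size.
Qed.

(** Transitivity of the identification of fresh pairs.  This is the step where
the domination of 5-wheels with a pendant triangle enters. *)
Lemma twin_trans w1 w2 w3 z :
  rigid w2 ->
  (forall u, vertex u -> size u < size w2 -> covers u) ->
  parents_clique w2 ->
  fresh w1 z -> fresh w2 z -> fresh w3 z ->
  sibling w1 w2 -> sibling w2 w3 -> twin w1 w3.
Proof.
move=> rig cov cl F1 F2 F3 s12 s23.
have [d13|nd13] := boolP (d (last o w1) (last o w3)).
  have [_ /(_ d13) e13] := rig w1 w3 (or_intror (sibling_sym s12)) (or_intror s23).
  by right; apply: edge_same_size e13 _; rewrite (sibling_size s12) (sibling_size s23).
have [E|/eqP n13] := eqVneq w1 w3; first by left.
have fn13 : last o w1 != last o w3.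
  apply/eqP => E; apply: n13.
  by have [->] := rig w1 w3 (or_intror (sibling_sym s12)) (or_intror s23).
exfalso.
have [d12 [u u1 u2]] := s12; have [d23 [u' u'2 u'3]] := s23.
have [[_ dz1 _] [_ dz2 _] [_ dz3 _]] := And3 F1 F2 F3.
have covu : covers u.
  by apply: cov; [case: (parent_vertex u2)|rewrite (parent_size u2)].
have covu' : covers u'.
  by apply: cov; [case: (parent_vertex u'2)|rewrite (parent_size u'2)].
have nuz : ~~ d (last o u) z by apply: fresh_far u2 F2.
have nu'z : ~~ d (last o u') z by apply: fresh_far u'2 F2.
have uz : last o u != z by apply/eqP; case: F2 => _ _; apply; left.
(* A common parent v would close the 4-wheel (w2; w1, z, w3, v). *)
have no_common v : parent v w1 -> parent v w2 -> parent v w3 -> False.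
  move=> v1 v2 v3.
  have := d_W4 (c := last o w2) (a1 := last o w1) (a2 := z) (a3 := last o w3)
    (a4 := last o v).
  have covv : covers v.
    by apply: cov; [case: (parent_vertex v2)|rewrite (parent_size v2)].
  have nvz := fresh_far covv v2 F2.
  rewrite /= (negbTE nd13) [d z (last o v)]d_sym (negbTE nvz) => W.
  suff : false by []; apply: W => //.
    by rewrite d_sym d12 dz2 d23 d_sym (parent_d v2).
    by rewrite dz1 d_sym dz3 d_sym (parent_d v3) (parent_d v1).
  by rewrite eq_sym; apply/eqP; case: F2 => _ _; apply; left.
have n1u' : ~~ d (last o w1) (last o u').
  apply/negP => D; apply: (no_common u') => //.
  have [_ /(_ D) e] := rig w1 u' (or_intror (sibling_sym s12)) (or_introl u'2).
  by apply: edge_lt_size e _; rewrite (sibling_size s12) (parent_size u'2).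
have n3u : ~~ d (last o w3) (last o u).
  apply/negP => D; apply: (no_common u) => //.
  have [_ /(_ D) e] := rig w3 u (or_intror s23) (or_introl u2).
  by apply: edge_lt_size e _; rewrite -(sibling_size s23) (parent_size u2).
case: (cl _ _ u2 u'2) => [E|suu'].
  by apply: (no_common u') => //; rewrite -E.
have [duu' [t tu tu']] := suu'.
have [liftu inju reflu] := covu.
have st : size w2 = (size t).+2 by rewrite (parent_size u2) (parent_size tu).
have eut : edge u t by left; left.
have eu2 : edge u w2 by right.
have nt2 : ~~ d (last o t) (last o w2).
  by apply/negP => /(reflu _ _ eut eu2)/edge_size; rewrite st ltnn.
have ft2 : last o t != last o w2.
  apply/eqP => /(inju _ _ eut eu2) E; move: (leqnSn (size t).+1).
  by rewrite -st -E ltnn.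
have wh : wheel5 d (last o w2) (last o u) (last o u') (last o w3) z (last o w1).
  have sym a b : d a b -> d b a by rewrite d_sym.
  have nsym a b : ~~ d a b -> ~~ d b a by rewrite d_sym.
  rewrite /wheel5 /= duu' nuz nu'z dz2 d23 dz3 (sym _ _ dz1) (parent_d u'3).
  rewrite (sym _ _ (parent_d u2)) (sym _ _ (parent_d u'2)) (sym _ _ d12).
  by rewrite (sym _ _ (parent_d u1)) (nsym _ _ n3u) (nsym _ _ n1u') (nsym _ _ nd13).
(* The grandparent t is too far from w2 to be in the wheel. *)
have [|||x] := d_W5 (t := last o t) wh.
- by rewrite d_sym; apply: parent_d tu.
- by rewrite d_sym; apply: parent_d tu'.
- have /andP[/allP spokes _] := wh.
  rewrite inE (negbTE ft2); apply: contra nt2 => /spokes.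
  by rewrite d_sym.
rewrite /= /within1 => /and5P[x2 xu _ _ /and4P[xz _ xt _]].
(* The dominating vertex x is adjacent, not equal, to u, t, w2 and z, because
   each of these misses another vertex of the configuration. *)
have nxz : x != z.
  by apply: contraNneq nuz => E; move: xu; rewrite E eq_sym (negbTE uz) /= d_sym.
have nxt : x != last o t.
  by apply: contraNneq nt2 => E; move: x2; rewrite E (negbTE ft2).
have nxu : x != last o u.
  by apply: contraNneq nuz => E; move: xz; rewrite E (negbTE uz).
have nx2 : x != last o w2.
  by apply: contraNneq nt2 => E; move: xt; rewrite E eq_sym (negbTE ft2) /= d_sym.
move: xu xt x2 xz; rewrite (negbTE nxz) (negbTE nxt) (negbTE nxu) (negbTE nx2) /=.
rewrite d_sym => /liftu[y uy <-] yt y2 yz.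
(* The lift y of x is adjacent to t and to w2, which are two spheres apart. *)
have et : edge y t by apply: reflu.
have e2 : edge y w2 by apply: reflu.
have y_2 : parent y w2.
  apply: edge_lt_size (edge_sym e2) _; rewrite st ltnS.
  by apply: edge_size (edge_sym et).
have covy : covers y.
  by apply: cov; [case: (parent_vertex y_2)|rewrite (parent_size y_2)].
by have /negP := fresh_far covy y_2 F2.
Qed.

(** The induction hypothesis after the construction of the sphere of radius [n].
Vertices of that sphere are only known to be rigid, as [covers] involves their
children. *)
Definition tame n := [/\ forall w, size w = n -> rigid w,
  forall u, vertex u -> size u < n -> covers u &
  forall x, size x <= n -> parents_clique x].

Lemma twin_sym w w' : twin w w' -> twin w' w.
Proof. by case=> [->|/sibling_sym]; [left|right]. Qed.

Lemma twin_size w w' : twin w w' -> size w = size w'.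
Proof. by case=> [->|/sibling_size]. Qed.

Lemma child_eq n w w' z : tame n -> size w = n -> fresh w z -> fresh w' z ->
  child w z = child w' z <-> twin w w'.
Proof.
move=> [rig cov cl] sw Fw Fw'.
have tr w1 w2 w3 : size w2 = n -> fresh w1 z -> fresh w2 z -> fresh w3 z ->
    twin w1 w2 -> twin w2 w3 -> twin w1 w3.
  move=> s2 F1 F2 F3 [-> //|t12] [<-|t23]; first by right.
  apply: (twin_trans (rig _ s2) _ _ F1 F2 F3 t12 t23).
    by rewrite s2.
  by apply: cl; rewrite s2.
pose Q v := fun w' => `[< fresh w' z /\ (w' = v \/ sibling w' v) >].
have QP v : fresh v z -> fresh (choose (Q v) v) z /\ twin (choose (Q v) v) v.
  move=> Fv; have /asboolP[] // : Q v (choose (Q v) v).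
  by apply: chooseP; apply/asboolP; split=> //; left.
rewrite /child /extend -/(Q w) -/(Q w'); split=> [/rcons_inj[E]|ww'].
  have [Fr tw] := QP _ Fw; have [_ tw'] := QP _ Fw'.
  apply: (tr _ (choose (Q w) w)) => //; first by rewrite (twin_size tw).
    exact: twin_sym.
  by rewrite E.
congr rcons; have QQ : Q w =1 Q w'.
  move=> v; apply: asbool_equiv_eq; split=> -[Fv tv]; split=> //.
    by apply: (tr _ w).
  by apply: (tr _ w') => //; [rewrite -(twin_size ww')|apply: twin_sym].
rewrite (eq_choose QQ); apply: choose_id; apply/asboolP; split=> //; last by left.
Qed.

Lemma parent_uniq w x y : parent w x -> parent w y -> last o x = last o y -> x = y.
Proof.
by move=> /parent_fresh[_ ->] /parent_fresh[_ ->]; rewrite !last_child => ->.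
Qed.

Lemma parents_twin n w w' x : tame n -> size w = n ->
  parent w x -> parent w' x -> twin w w'.
Proof.
move=> tn sw /parent_fresh[Fw xE] /parent_fresh[Fw' xE'].
by apply/(child_eq tn sw Fw Fw'); rewrite -xE -xE'.
Qed.

Lemma parent_twin n w w' x : tame n -> size w = n ->
  parent w x -> fresh w' (last o x) -> twin w w' -> parent w' x.
Proof.
move=> tn sw /parent_fresh[Fw xE] Fw' /(child_eq tn sw Fw Fw') E.
by apply/parentP; exists (last o x); rewrite // -E.
Qed.

(** A neighbour [u] of [w] in the ball whose image is adjacent to that of a new
child [x] of [w] is itself a parent of [x]: the pair formed by [u] and the image
of [x] is fresh, since a vertex seen from [u] there would be seen from [w]. *)
Lemma lower_parent n w u x : tame n -> size w = n ->
  lower w u -> parent w x -> d (last o u) (last o x) -> parent u x.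
Proof.
move=> tn sw wu wx dux; have [rig cov _] := tn; have [Fw _] := parent_fresh wx.
case: wu => [uw|swu].
  have covu : covers u.
    by apply: cov; [case: (parent_vertex uw)|rewrite -sw (parent_size uw)].
  by have /negP := fresh_far covu uw Fw.
apply: (parent_twin tn sw wx); last by right.
split=> // [|y uy E]; first by case: (sibling_vertex swu).
have su : size u = n by rewrite -(sibling_size swu).
have [_] := rig u su w y (or_intror (sibling_sym swu)) uy.
rewrite E (parent_d wx) => /(_ isT) wy; case: Fw => _ _ /(_ y); apply=> //.
by apply: edge_lower wy _; rewrite (sibling_size swu) lower_size.
Qed.

(** Children of [w] supply exactly the neighbours of its image that were
missing. *)
Lemma covers_succ n w : tame n -> vertex w -> size w = n -> covers w.
Proof.
move=> tn Vw sw; have [rig cov cl] := tn; have rw := rig w sw.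
have cross x y : lower w x -> parent w y -> d (last o x) (last o y) -> edge x y.
  by move=> wx wy dxy; right; apply: lower_parent tn sw wx wy dxy.
split=> [z dwz|x y|x y].
- have [[x wx xz]|nx] := pselect (exists2 x, lower w x & last o x = z).
    by exists x => //; left.
  have Fw : fresh w z by split=> // x wx xz; apply: nx; exists x.
  by exists (child w z); [right; apply: parent_child|apply: last_child].
- move=> [wx|wx] [wy|wy] E.
  + by case: (rw x y wx wy) => ->.
  + by have [[_ _ /(_ _ wx)/(_ E)]] := parent_fresh wy.
  + by have [[_ _ /(_ _ wy)/(_ (esym E))]] := parent_fresh wx.
  + exact: parent_uniq wx wy E.
- move=> [wx|wx] [wy|wy] D.
  + by case: (rw x y wx wy) => _; apply.
  + exact: cross.
  + by apply: edge_sym; apply: cross; rewrite // d_sym.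
  + by left; right; split=> //; exists w.
Qed.

(** Among the neighbours of [x] in the new ball, any two parents are adjacent or
equal, and [lower_parent] settles a parent against a sibling.  For two siblings
[a], [b] with adjacent images, obtained from parents [w] and [v] of [x], either
[w] or [v] is a common parent of [a] and [b], or the images of [w], [a], [b], [v]
are the rim of a 4-wheel around the image of [x]. *)
Lemma rigid_succ n x : tame n -> size x = n.+1 -> rigid x.
Proof.
move=> tn sx; have [rig cov cl] := tn.
have sz w : parent w x -> size w = n.
  by move=> /parent_size; rewrite sx => -[].
have tw w w' : parent w x -> parent w' x -> twin w w'.
  by move=> wx; apply: (parents_twin tn (sz _ wx) wx).
(* The sibling y of x is a child of a parent v of x, and v is w or one of its
   siblings; so w and y can be compared in the star of v. *)
have cross w y : parent w x -> sibling x y ->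
    (last o w <> last o y) /\ (d (last o w) (last o y) -> parent w y).
  move=> wx [dxy [v vx vy]]; have [vw|svw] := tw _ _ vx wx.
    subst v; split=> // E; by have := parent_d vy; rewrite E d_irr.
  have [[_ _ ov] _] := parent_fresh vy; split=> [|dwy]; first by apply: ov; right.
  exact: lower_parent tn (sz _ vx) (or_intror svw) vy dwy.
move=> a b [ax|xa] [bx|xb].
- case: (tw _ _ ax bx) => [->|sab]; first by rewrite d_irr.
  split=> [E|_]; last by left; right.
  by case: sab; rewrite E d_irr.
- have [ne D] := cross _ _ ax xb; split=> // dab; right; exact: D.
- have [ne D] := cross _ _ bx xa; split=> [E|]; first by case: ne.
  by rewrite d_sym => /D; left; left.
have [dxa [w wx wa]] := xa; have [dxb [v vx vb]] := xb.
have [Fwa aE] := parent_fresh wa; have [Fvb bE] := parent_fresh vb.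
split=> [E|dab].
  rewrite aE bE -E; rewrite -E in Fvb.
  by apply/(child_eq tn (sz _ wx) Fwa Fvb); apply: tw.
have done_ u : parent u a -> parent u b -> edge a b.
  by move=> ua ub; left; right; split=> //; exists u.
have [nwb Dwb] := cross _ _ wx xb; have [nva Dva] := cross _ _ vx xa.
have [/Dwb|nd1] := boolP (d (last o w) (last o b)); first exact: done_.
have [/Dva|nd2] := boolP (d (last o v) (last o a)); first by move=> va; apply: done_ vb.
case: (tw _ _ wx vx) => [E|[dwv _]].
  by apply: (done_ w) => //; rewrite E.
exfalso; have := d_W4 (c := last o x) (a1 := last o w) (a2 := last o a)
  (a3 := last o b) (a4 := last o v).
have sym p q : d p q -> d q p by rewrite d_sym.
rewrite (negbTE nd1) [d (last o a) (last o v)]d_sym (negbTE nd2) /=.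
rewrite dxa dxb dab (parent_d wa).
rewrite (sym _ _ (parent_d wx)) (sym _ _ (parent_d vx)) (sym _ _ (parent_d vb)).
rewrite (sym _ _ dwv).
move=> W; suff: false by []; apply: W => //; first exact/eqP.
by apply/eqP => /esym.
Qed.

Lemma tame_succ n : tame n -> tame n.+1.
Proof.
move=> tn; have [rig cov cl] := tn; split=> [w|u Vu|x].
- exact: rigid_succ.
- by rewrite ltnS leq_eqVlt => /predU1P[/(covers_succ tn Vu)|/(cov _ Vu)].
rewrite leq_eqVlt => /predU1P[sx w w' wx|]; last exact: cl.
by apply: (parents_twin tn _ wx); have := parent_size wx; rewrite sx => -[].
Qed.

Lemma tame0 : tame 0.
Proof.
split=> // [w /size0nil -> x y [/parent_size//|[_ [? _ /parent_size]]]|x] //.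
by rewrite leqn0 => /nilP -> w w' /parent_size.
Qed.

Lemma all_tame n : tame n.
Proof. by elim: n => [|n]; [apply: tame0|apply: tame_succ]. Qed.

Lemma vertex_covers w : vertex w -> covers w.
Proof. by move=> Vw; apply: (covers_succ (all_tame _)). Qed.

Lemma vertex_parents_clique x : parents_clique x.
Proof. by have [_ _ cl] := all_tame (size x); apply: cl. Qed.

Lemma vertex_ind (Q : seq T -> Prop) : Q [::] ->
  (forall u w, parent u w -> vertex u -> Q u -> Q w) -> forall w, vertex w -> Q w.
Proof.
move=> Q0 QS w; elim: (size w) {-2}w (leqnn (size w)) => [|n IHn] {}w sw [->//|[u uw]].
  by move: sw; rewrite (parent_size uw).
have [Vu _] := parent_vertex uw; apply: (QS u) => //; apply: IHn => //.
by rewrite -ltnS -(parent_size uw).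
Qed.

Lemma vertex_path w : vertex w ->
  exists p, [/\ path d o p, last o p = last o w & size p = size w].
Proof.
elim/vertex_ind=> [|u {}w uw _ [p [dp lp sp]]]; first by exists [::].
exists (rcons p (last o w)); split; last by rewrite size_rcons sp (parent_size uw).
  by rewrite rcons_path dp lp parent_d.
by rewrite last_rcons.
Qed.

(** Paths lift, and a step changes the level by at most one. *)
Lemma path_vertex p : path d o p ->
  exists w, [/\ vertex w, last o w = last o p & size w <= size p].
Proof.
elim/last_ind: p => [|p z IHp]; first by exists [::]; split=> //; left.
rewrite rcons_path last_rcons size_rcons => /andP[/IHp[w [Vw <- sw]]].
have [lift _ _] := vertex_covers Vw => /lift[x wx <-]; exists x; split=> //.
  by case: (edge_vertex wx).
exact: leq_trans (edge_size wx) _.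
Qed.

End Unfolding.

(** * Lifting homotopies *)

(** A covering of the 1-skeleton of [Y] is given by a graph on the points of [P]:
[e] is its adjacency relation and [g] its projection. *)
Section PathLifting.
Variables (W : choiceType) (Y : complex W) (S : Type) (e : S -> S -> Prop) (g : S -> W).
Variable P : S -> Prop.
Hypotheses (e_sym : forall a b, e a b -> e b a).
Hypothesis e_P : forall a b, e a b -> P b.
Hypothesis e_adj : forall a b, e a b -> adj Y (g a) (g b).
Hypothesis e_iso : forall a, P a -> star_iso e (adj Y) g a.

(** Some edge path from [a] to [b] projects to the vertex sequence [s].  The
sequence contains its initial vertex, like those in [homotopic]. *)
Fixpoint lifts (s : seq W) (a b : S) : Prop :=
  match s with
  | [::] => False
  | u :: s' => g a = u /\
      if s' is _ :: _ then exists2 c, e a c & lifts s' c b else a = b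
  end.

Lemma lifts_cat p u s s' :
  (forall a b, P a -> lifts (u :: s) a b <-> lifts (u :: s') a b) ->
  forall a b, P a -> lifts (p ++ u :: s) a b <-> lifts (p ++ u :: s') a b.
Proof.
move=> E; elim: p => [|x p IHp] //= a b Pa.
have {}IHp c : e a c -> lifts (p ++ u :: s) c b <-> lifts (p ++ u :: s') c b.
  by move=> ac; apply: IHp; apply: e_P ac.
case: p IHp => [|y p] IHp /=.
  by split=> -[ax [c ac cb]]; split=> //; exists c => //; apply/(IHp c).
by split=> -[ax [c ac cb]]; split=> //; exists c => //; apply/(IHp c).
Qed.

(** The lift of a backtrack returns to its origin by local injectivity, and the
lift of a triangle closes up because adjacency is reflected on stars. *)
Lemma lifts_homotopic s s' : homotopic Y s s' ->
  forall a b, P a -> lifts s a b <-> lifts s' a b.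
Proof.
elim=> {s s'} [//|s s' _ IH a b Pa|s s' s'' _ IH _ IH' a b Pa|p q u v uv|p q u v w].
- by rewrite (IH a b Pa).
- by rewrite (IH a b Pa) IH'.
- apply: lifts_cat => a b Pa; have [lift inj _] := e_iso Pa.
  split=> [[au [c ac [cv [x cx]]]]|].
    have Pc := e_P ac; have [_ injc _] := e_iso Pc.
    move=> L; suff <- : x = a by [].
    by apply: injc => //; [apply: e_sym|rewrite au; case: L].
  move=> L; have [au _] := L.
  have [|c ac cv] := lift v; first by rewrite au.
  by split=> //; exists c => //; split=> //; exists a => //; apply: e_sym.
move=> uvw Yuvw; move: uvw; rewrite /= !inE negb_or andbT => /andP[/andP[uv uw] vw].
have [auv auw avw] : [/\ adj Y u v, adj Y u w & adj Y v w].
  by split; apply: (simplex_adj Yuvw) => //; rewrite !inE eqxx ?orbT.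
apply: lifts_cat => a b Pa; have [lift inj refl] := e_iso Pa.
have hd c s : lifts (w :: s) c b -> g c = w by case.
split=> [[au [c ac [cv [x cx L]]]]|[au [x ax L]]].
  split=> //; exists x => //.
  have [_ _ reflc] := e_iso (e_P ac).
  by apply: reflc; rewrite ?(hd _ _ L) ?au //; apply: e_sym.
have [|c ac cv] := lift v; first by rewrite au.
split=> //; exists c => //; split=> //; exists x => //.
by apply: refl; rewrite ?cv ?(hd _ _ L).
Qed.

Lemma lifts_path u p a b : lifts (u :: p) a b -> path (adj Y) u p /\ last u p = g b.
Proof.
elim: p u a => [|v p IHp] u a /= [<-]; first by move=> ->.
move=> [c ac L]; have [-> ->] := IHp _ _ L; split=> //; rewrite andbT.
have <- : g c = v by case: L.
exact: e_adj.
Qed.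

Definition linked a b := exists p, lifts (g a :: p) a b.

Lemma linked_edge a b c : e a b -> linked b c -> linked a c.
Proof. by move=> ab [p L]; exists (g b :: p); split=> //; exists b. Qed.

Lemma linked_trans a b c : linked a b -> linked b c -> linked a c.
Proof.
move=> [p]; elim: p a => [|v p IHp] a [_]; first by move=> ->.
move=> [x ax L] bc; apply: (linked_edge ax); apply: IHp bc.
by suff -> : g x = v by []; case: L.
Qed.

Lemma linked_refl a : linked a a.
Proof. by exists [::]. Qed.

Lemma linked_sym a b : linked a b -> linked b a.
Proof.
move=> [p]; elim: p a => [|v p IHp] a [_]; first by move=> ->; apply: linked_refl.
move=> [x ax L]; apply: (@linked_trans _ x); last first.
  by apply: (@linked_edge x a); [apply: e_sym|apply: linked_refl].
by apply: IHp; suff -> : g x = v by []; case: L.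
Qed.

(** A path joining two points of a fibre projects to a closed path.  That path is
homotopic to a constant one, whose lifts are constant. *)
Lemma simply_connected_inj a b :
  simply_connected Y -> P a -> linked a b -> g a = g b -> a = b.
Proof.
move=> [_ sc] Pa [p L] ab; have [pp lp] := lifts_path L.
have H := sc _ _ pp (etrans lp (esym ab)).
by have /(lifts_homotopic H b Pa)[] := L.
Qed.

End PathLifting.

(** * Distances to the base vertex *)

Section Balls.
Variables (W : choiceType) (Y : complex W) (o : W).
Hypotheses (Y_flag : flag Y) (Y_cliques : no_infinite_clique Y).
Hypotheses (Y_sc : simply_connected Y).
Hypotheses (Y_W4 : W4_free (adj Y)) (Y_W5 : W5_dominated (adj Y)).
Local Notation d := (adj Y).
Local Notation vtx := (vertex d o).
Let dsym := adj_sym Y.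
Let dirr := adj_irr Y.

Lemma last_inj x y : vtx x -> vtx y -> last o x = last o y -> x = y.
Proof.
move=> Vx Vy; have root w : vtx w -> linked (edge d o) (last o) [::] w.
  elim/vertex_ind=> [|u {}w uw _ IH]; first exact: linked_refl.
  apply: linked_trans IH _; apply: linked_edge (linked_refl _ _ _).
  by right.
apply: (@simply_connected_inj _ Y _ (edge d o) (last o) vtx) => //.
- by move=> a b; apply: edge_sym.
- by move=> a b /edge_vertex[].
- by move=> a b; apply: edge_d.
- by move=> a; apply: vertex_covers.
apply: linked_trans (root _ Vy); apply: linked_sym (root _ Vx).
by move=> a b; apply: edge_sym.
Qed.

Lemma adj_edge x y : vtx x -> vtx y -> d (last o x) (last o y) -> edge d o x y.
Proof.
move=> Vx Vy; have [lift _ _] := vertex_covers dsym dirr Y_W4 Y_W5 Vx.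
move=> /lift[z xz zy]; rewrite -(last_inj _ Vy zy) //.
by case: (edge_vertex xz).
Qed.

Lemma dist_leP i y : dist_le Y [set o]%classic i y <->
  exists x, [/\ vtx x, last o x = y & size x <= i].
Proof.
split=> [[a [p [-> dp lp sp]]]|[x [Vx <- sx]]].
  have [x [Vx lx sx]] := path_vertex dsym dirr Y_W4 Y_W5 dp.
  by exists x; split=> //; [rewrite lx|apply: leq_trans sp].
have [p [dp lp sp]] := vertex_path Vx.
by exists o, p; split; rewrite // sp.
Qed.

Lemma dist_eq_vertex i y : dist_eq Y [set o]%classic i y ->
  exists x, [/\ vtx x, last o x = y & size x = i].
Proof.
move=> [/dist_leP[x [Vx xy sx]] far]; exists x; split=> //.
apply/eqP; rewrite eqn_leq sx leqNgt; apply/negP => lt.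
by apply: (far _ lt); apply/dist_leP; exists x.
Qed.

Lemma parent_dist w x i : parent d o w x -> size x = i.+1 ->
  dist_le Y [set o]%classic i (last o w).
Proof.
move=> wx; rewrite (parent_size wx) => -[<-]; apply/dist_leP; exists w; split=> //.
by case: (parent_vertex wx).
Qed.


(** Condition (E): the lifts of the ends of [e] are siblings, hence have a common
parent. *)
Lemma edge_condition i e : sphere Y i.+1 [set o]%classic e -> #|` e| = 2 ->
  (link Y e `&` ball Y i [set o] !=set0)%classic.
Proof.
move=> [Ye far] e2.
have [a ae] : exists a, a \in e by apply/fset0Pn; rewrite -cardfs_gt0 e2.
have [b] : exists b, b \in e `\ a.
  by apply/fset0Pn; rewrite -cardfs_gt0; move: e2; rewrite (cardfsD1 a) ae add1n => -[->].
rewrite !inE => /andP[ba be].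
have eE : e = [fset a; b].
  apply/esym/eqP; rewrite eqEfcard e2 cardfs2 eq_sym ba leqnn andbT.
  by apply/fsubsetP => c; rewrite !inE => /orP[] /eqP->.
have [x [Vx xa sx]] := dist_eq_vertex (far _ ae).
have [y [Vy yb sy]] := dist_eq_vertex (far _ be).
have ab : d a b by apply: simplex_adj Ye ae be _; rewrite eq_sym.
have : edge d o x y by apply: adj_edge; rewrite // xa yb.
move=> /edge_same_size; rewrite sx sy => /(_ erefl)[_ [w wx wy]].
have wa : d (last o w) a by rewrite -xa; apply: parent_d.
have wb : d (last o w) b by rewrite -yb; apply: parent_d.
have ne z : d (last o w) z -> (last o w == z) = false by case/andP => /negbTE.
exists [fset last o w]; split; split.
- exact: simplex_vertex.
- by rewrite fdisjoint1X eE !inE !ne.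
- apply: Y_flag; first by apply/fset0Pn; exists (last o w); rewrite !inE eqxx.
  rewrite eE => u v; rewrite !inE.
  by move=> /or3P[] /eqP-> /or3P[] /eqP->; rewrite ?eqxx // dsym.
- exact: simplex_vertex.
- by move=> z; rewrite inE => /eqP->; apply: parent_dist wx sx.
Qed.

(** Condition (V): the neighbours of [w] in the ball are the images of the parents
of its lift, which form a nonempty clique. *)
Lemma vertex_condition i w : sphere Y i.+1 [set o]%classic [fset w] ->
  exists2 s, Y s & (link Y [fset w] `&` ball Y i [set o])%classic = faces s.
Proof.
move=> [_ /(_ w)]; rewrite inE eqxx => /(_ isT)/dist_eq_vertex[x [Vx xw sx]].
pose A := [set y | d w y /\ dist_le Y [set o]%classic i y]%classic.
have Apar y : A y -> exists2 u, parent d o u x & last o u = y.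
  move=> [wy /dist_leP[u [Vu uy su]]]; exists u => //.
  apply: edge_lt_size; last by rewrite sx ltnS.
  by apply: adj_edge; rewrite // xw uy.
have Acl u v : A u -> A v -> u != v -> d u v.
  move=> /Apar[p px <-] /Apar[q qx <-] pq.
  case: (vertex_parents_clique dsym dirr Y_W4 Y_W5 px qx) => [E|[//]].
  by rewrite E eqxx in pq.
have Afin : finite_set A by apply: Y_cliques.
have memA y : y \in fset_set A -> A y by rewrite in_fset_set // in_setE.
have memA' y : A y -> y \in fset_set A by rewrite in_fset_set // in_setE.
have YA : Y (fset_set A).
  apply: Y_flag; last by move=> u v /memA Au /memA Av; apply: Acl.
  have [x0|[p px]] := Vx; first by rewrite x0 in sx.
  apply/fset0Pn; exists (last o p); apply: memA'; split.
    by rewrite dsym -xw; apply: parent_d.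
  exact: parent_dist px sx.
exists (fset_set A) => //; apply/seteqP; split=> t.
- move=> [[Yt tw Ytw] [_ tball]]; split; first exact: simplex_neq0 Yt.
  apply/fsubsetP => y yt; apply: memA'; split; last exact: tball.
  apply: (simplex_adj Ytw); rewrite ?inE ?eqxx ?orbT ?yt //.
  by move: tw; rewrite fdisjointX1; apply: contraNneq => ->.
move=> [t0 /fsubsetP tA]; have Yt : Y t by apply: simplex_face YA t0 _; apply/fsubsetP.
have wt y : y \in t -> d w y by case/tA/memA.
split; split=> //; last by move=> y /tA/memA[].
  by rewrite fdisjointX1; apply/negP => /wt; rewrite dirr.
apply: Y_flag; first by apply/fset0Pn; exists w; rewrite !inE eqxx orbT.
move=> u v; rewrite !inE => /orP[ut|/eqP->] /orP[vt|/eqP->]; rewrite ?eqxx //.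
- by apply: Acl; apply: memA; apply: tA.
- by rewrite dsym wt.
- by rewrite wt.
Qed.

End Balls.

(** * The universal cover *)

Theorem theoremB (V : choiceType) (X : complex V)
    (Xconn : connected X) (Xcliques : no_infinite_clique X)
    (XSD : SD2star X)
    (W : choiceType) (Y : complex W) (f : W -> V)
    (Yuniv : universal_cover X Y f) :
  weakly_systolic Y.
Proof.
have [f_cov Y_sc] := Yuniv; have [X_flag _ _] := XSD.
have hom := covering_adj f_cov; have iso := covering_star_iso f_cov X_flag.
have Y_flag := covering_flag f_cov X_flag.
have Y_cliques := covering_cliques f_cov Xcliques.
have Y_W4 : W4_free (adj Y) := star_iso_W4 hom iso (W4_free_adj XSD).
have Y_W5 : W5_dominated (adj Y).
  exact: star_iso_W5 (adj_sym Y) (adj_sym X) (adj_irr X) hom iso (W5_dominated_adj XSD).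
split=> // n v i _; split=> [e|w].
- exact: edge_condition.
- exact: vertex_condition.
Qed.
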